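(* Let $\mathbb{GA}_N$ be an $N$-dimensional manifold with a non-symmetric affine connection with coefficients $L^i_{jk}$. Consider the family of curvature tensors $$\rho^i_{jmn}=R^i_{jmn}+uL^i_{\underset{\vee}{jm}|n}+u'L^i_{\underset{\vee}{jn}|m}+vL^\alpha_{\underset{\vee}{jm}}L^i_{\underset{\vee}{\alpha n}}+v'L^\alpha_{\underset{\vee}{jn}}L^i_{\underset{\vee}{\alpha m}}+wL^\alpha_{\underset{\vee}{mn}}L^i_{\underset{\vee}{j\alpha}},$$ for the corresponding coefficients $u,u',v,v',w$ (the fourteen tuples listed in the context). Six of the curvature tensors from this family are linearly independent, i.e. the maximal number of linearly independent tensors in the family is six.
   Context: The coefficients $L^i_{jk}$ are in general not symmetric in $j,k$. Put $L^i_{\underline{jk}}=\frac12(L^i_{jk}+L^i_{kj})$ and $L^i_{\underset{\vee}{jk}}=\frac12(L^i_{jk}-L^i_{kj})$. A comma denotes a partial derivative, $|$ denotes covariant differentiation with respect to the symmetric connection with coefficients $L^i_{\underline{jk}}$, repeated Greek indices are summed, and $R^i_{jmn}=L^i_{\underline{jm},n}-L^i_{\underline{jn},m}+L^\alpha_{\underline{jm}}L^i_{\underline{\alpha n}}-L^\alpha_{\underline{jn}}L^i_{\underline{\alpha m}}$. The curvature tensors in the family are $\rho_1,\ldots,\rho_{14}$, with coefficient tuples $(u,u',v,v',w)$: $\rho_1:(1,-1,1,-1,-2)$; $\rho_2:(1,-1,-1,-1,0)$; $\rho_3:(1,-1,1,-1,0)$; $\rho_4:(-1,-1,-1,-1,0)$;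 $\rho_5:(-1,-1,1,-1,-2)$; $\rho_6:(-1,-1,-1,-1,-2)$; $\rho_7:(1,-1,-1,1,2)$; $\rho_8:(1,-1,1,1,2)$; $\rho_9:(1,-1,1,-1,2)$; $\rho_{10}:(-1,1,-1,1,2)$; $\rho_{11}:(-1,1,1,-1,-2)$; $\rho_{12}:(-1,1,-1,1,-2)$; $\rho_{13}:(1,-1,1,1,0)$; $\rho_{14}:(-1,-1,1,1,0)$. Linear independence is over $\mathbb R$, the tensors being treated as vectors whose components are the coefficients of the six terms $R^i_{jmn}$, $L^i_{\underset{\vee}{jm}|n}$, $L^i_{\underset{\vee}{jn}|m}$, $L^\alpha_{\underset{\vee}{jm}}L^i_{\underset{\vee}{\alpha n}}$, $L^\alpha_{\underset{\vee}{jn}}L^i_{\underset{\vee}{\alpha m}}$, $L^\alpha_{\underset{\vee}{mn}}L^i_{\underset{\vee}{j\alpha}}$. *)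

(* Defs.v *)
From HB Require Import structures.
From mathcomp Require Import all_boot all_order all_algebra.
From mathcomp Require Import all_classical all_reals all_analysis.
Set Implicit Arguments. Unset Strict Implicit. Unset Printing Implicit Defensive.
Import Order.TTheory GRing.Theory Num.Theory.
Import numFieldNormedType.Exports.
Local Open Scope classical_set_scope.
Local Open Scope ring_scope.

Definition partial (R : realType) (N : nat) (k : 'I_N)
    (f : 'rV[R]_N -> R) : 'rV[R]_N -> R :=
  fun x => 'D_(delta_mx 0 k) f x.

(* On an open V this is C^oo: a function all of whose iterated partial
   derivatives exist and are differentiable has continuous ones. *)
Definition smooth_on (R : realType) (N : nat) (V : set 'rV[R]_N)
    (f : 'rV[R]_N -> R) : Prop :=
  forall (s : seq 'I_N) (x : 'rV[R]_N), V x ->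
    differentiable (foldr (@partial R N) f s) x.

(* [chart_map a] and [chart_param a] are only meaningful on [chart_dom a] and on
   its image, respectively. *)
Record manifold (R : realType) (N : nat) : Type := Manifold {
  carrier : topologicalType;
  chart_index : Type;
  chart_dom : chart_index -> set carrier;
  chart_map : chart_index -> carrier -> 'rV[R]_N;
  chart_param : chart_index -> 'rV[R]_N -> carrier;
  carrier_hausdorff : hausdorff_space carrier;
  carrier_second_countable : @second_countable carrier;
  chart_dom_cover : forall p : carrier, exists a, chart_dom a p;
  chart_dom_open : forall a, open (chart_dom a);
  chart_image_open : forall a, open (chart_map a @` chart_dom a);
  chart_mapK : forall a p, chart_dom a p -> chart_param a (chart_map a p) = p;
  chart_map_continuous : forall a,
    {within chart_dom a, continuous (chart_map a)};
  chart_param_continuous : forall a,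
    {within chart_map a @` chart_dom a, continuous (chart_param a)};
  transition_smooth : forall a b (i : 'I_N),
    smooth_on (chart_map a @` (chart_dom a `&` chart_dom b))
      (fun x => chart_map b (chart_param a x) 0 i)
}.

Definition transition (R : realType) (N : nat) (M : manifold R N)
    (a b : chart_index M) (i : 'I_N) : 'rV[R]_N -> R :=
  fun x => chart_map b (chart_param a x) 0 i.

(* [coef a i j k] is L^i_{jk} in the coordinates of the chart [a]; no symmetry
   in j, k is assumed. [coef_change] is the classical law
   L'^i_{pq} x'^p_{,j} x'^q_{,k} = x'^i_{,s} L^s_{jk} - x'^i_{,jk}. *)
Record connection (R : realType) (N : nat) (M : manifold R N) : Type :=
  Connection {
  coef : chart_index M -> 'I_N -> 'I_N -> 'I_N -> 'rV[R]_N -> R;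
  coef_smooth : forall a i j k,
    smooth_on (chart_map a @` chart_dom a) (coef a i j k);
  coef_change : forall (a b : chart_index M) (i j k : 'I_N) (x : 'rV[R]_N),
    (chart_map a @` (chart_dom a `&` chart_dom b)) x ->
    \sum_(p < N) \sum_(q < N)
      coef b i p q (chart_map b (chart_param a x))
      * partial j (transition a b p) x * partial k (transition a b q) x
    = \sum_(s < N) partial s (transition a b i) x * coef a s j k x
      - partial k (partial j (transition a b i)) x
}.

Section Curvature.
Variables (R : realType) (N : nat) (M : manifold R N) (L : connection M).
Implicit Types (a : chart_index M) (i j k m n : 'I_N).

Definition Lsym a i j k : 'rV[R]_N -> R :=
  fun x => 2%:R^-1 * (coef L a i j k x + coef L a i k j x).

Definition Lskew a i j k : 'rV[R]_N -> R :=
  fun x => 2%:R^-1 * (coef L a i j k x - coef L a i k j x).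

(* T^i_{jm|n} for a tensor T of type (1,2), with respect to [Lsym] *)
Definition cov_deriv a (T : 'I_N -> 'I_N -> 'I_N -> 'rV[R]_N -> R)
    i j m n : 'rV[R]_N -> R :=
  fun x => partial n (T i j m) x
    + \sum_(al < N) Lsym a i al n x * T al j m x
    - \sum_(al < N) Lsym a al j n x * T i al m x
    - \sum_(al < N) Lsym a al m n x * T i j al x.

Definition Rsym a i j m n : 'rV[R]_N -> R :=
  fun x => partial n (Lsym a i j m) x - partial m (Lsym a i j n) x
    + \sum_(al < N) Lsym a al j m x * Lsym a i al n x
    - \sum_(al < N) Lsym a al j n x * Lsym a i al m x.

Definition curvature (c : int * int * int * int * int) a i j m n :
    'rV[R]_N -> R :=
  let: (u, u', v, v', w) := c in
  fun x => Rsym a i j m n x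
    + u%:~R * cov_deriv a (Lskew a) i j m n x
    + u'%:~R * cov_deriv a (Lskew a) i j n m x
    + v%:~R * (\sum_(al < N) Lskew a al j m x * Lskew a i al n x)
    + v'%:~R * (\sum_(al < N) Lskew a al j n x * Lskew a i al m x)
    + w%:~R * (\sum_(al < N) Lskew a al m n x * Lskew a i j al x).

Definition basic_term (t : 'I_6) a i j m n : 'rV[R]_N -> R :=
  fun x => [:: Rsym a i j m n x;
    cov_deriv a (Lskew a) i j m n x;
    cov_deriv a (Lskew a) i j n m x;
    \sum_(al < N) Lskew a al j m x * Lskew a i al n x;
    \sum_(al < N) Lskew a al j n x * Lskew a i al m x;
    \sum_(al < N) Lskew a al m n x * Lskew a i j al x]`_t.

End Curvature.

(* (u, u', v, v', w) for rho_1, ..., rho_14, so rho_k is at index k - 1. *)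
Definition rho : 14.-tuple (int * int * int * int * int) :=
  [tuple ( 1, -1,  1, -1, -2);
         ( 1, -1, -1, -1,  0);
         ( 1, -1,  1, -1,  0);
         (-1, -1, -1, -1,  0);
         (-1, -1,  1, -1, -2);
         (-1, -1, -1, -1, -2);
         ( 1, -1, -1,  1,  2);
         ( 1, -1,  1,  1,  2);
         ( 1, -1,  1, -1,  2);
         (-1,  1, -1,  1,  2);
         (-1,  1,  1, -1, -2);
         (-1,  1, -1,  1, -2);
         ( 1, -1,  1,  1,  0);
         (-1, -1,  1,  1,  0)].

(* The tensor viewed as a formal combination of the six basic terms: for a
   particular connection these may be linearly dependent as functions (for
   instance when L is symmetric), so independence is that of these vectors. *)
Definition coef_vec (R : realType) (c : int * int * int * int * int) :
    'rV[R]_6 :=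
  let: (u, u', v, v', w) := c in
  \row_(t < 6) [:: 1; u%:~R; u'%:~R; v%:~R; v'%:~R; w%:~R]`_t.

Definition lin_independent (R : realType) (A : {set 'I_14}) : bool :=
  free [seq coef_vec R (tnth rho k) | k <- enum A].

(* Main.v *)
(** All the tensors are vectors of a six-dimensional space, which bounds the
    number of independent ones. The bound is attained by
    rho_1, rho_2, rho_3, rho_4, rho_7, rho_10: the differences rho_3 - rho_1,
    rho_3 - rho_2, rho_2 - rho_4, rho_7 - rho_2, rho_10 - rho_4 isolate in turn
    the terms with coefficients w, v, u, v', u', and what remains of rho_2 is
    the term R^i_{jmn}. *)
Require Import Defs.
From HB Require Import structures.
From mathcomp Require Import all_boot all_order all_algebra.
From mathcomp Require Import all_classical all_reals all_analysis.
From mathcomp Require Import lra.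
Set Implicit Arguments. Unset Strict Implicit. Unset Printing Implicit Defensive.
Import Order.TTheory GRing.Theory Num.Theory.
Import numFieldNormedType.Exports.
Local Open Scope classical_set_scope.
Local Open Scope ring_scope.

Lemma curvatureE (R : realType) (N : nat) (M : manifold R N)
    (L : connection M) (c : int * int * int * int * int)
    (a : chart_index M) (i j m n : 'I_N) (x : 'rV[R]_N) :
  curvature L c a i j m n x
  = \sum_(t < 6) coef_vec R c 0 t * basic_term L t a i j m n x.
Proof.
case: c => [[[[u u'] v] v'] w].
rewrite !big_ord_recl big_ord0 /coef_vec /basic_term !mxE /=.
by rewrite mul1r addr0 !addrA.
Qed.

Lemma free_size_le_dim (K : fieldType) (V : vectType K) (X : seq V) :
  free X -> (size X <= \dim {:V})%N.
Proof. by move=> /eqP <-; exact/dimvS/subvf. Qed.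

(** Indices into [rho] start at 0: these stand for rho_1, rho_2, rho_3, rho_4, rho_7, rho_10. *)
Definition basis_indices : seq 'I_14 :=
  [seq inord k | k <- [:: 0; 1; 2; 3; 6; 9]%N].

Lemma uniq_basis_indices : uniq basis_indices.
Proof.
rewrite map_inj_in_uniq // => k l kin lin /(congr1 val).
(* [inord] sends every number from 14 on to 0, so injectivity rests on this bound. *)
have bound : {in [:: 0; 1; 2; 3; 6; 9]%N, forall h, (h < 14)%N} by apply/allP.
by rewrite /= !inordK ?bound.
Qed.

Lemma free_basis_rho (R : realType) :
  free [seq coef_vec R (tnth rho k) | k <- basis_indices].
Proof.
rewrite /= !(tnth_nth (0, 0, 0, 0, 0)) !inordK //=.
set X := (X in free X); apply/(@freeP _ _ 6 (in_tuple X)) => c.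
rewrite !big_ord_recl big_ord0 /= => /rowP c0.
(* One equation per basic term: a 6 by 6 homogeneous system in the values of [c]. *)
have := (c0 (inord 0), c0 (inord 1), c0 (inord 2), c0 (inord 3), c0 (inord 4),
  c0 (inord 5)).
rewrite !mxE !inordK //= => -[[[[[e0 e1] e2] e3] e4] e5].
have zero : all (fun t => c t == 0) (enum 'I_6).
  (* This writes the indices with [lift], as [big_ord_recl] did in the equations, so that [lra]
     meets the same unknowns. *)
  rewrite !enum_ordSl (size0nil (size_enum_ord 0)) /=.
  by do 6?[apply/andP; split]=> //; apply/eqP; lra.
by move=> t; apply/eqP/(allP zero)/mem_enum.
Qed.

Theorem theorem2p3 (R : realType) (N : nat) (M : manifold R N)
    (L : connection M) :
  (forall (k : 'I_14) (a : chart_index M) (i j m n : 'I_N) (x : 'rV[R]_N),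
     (chart_map a @` chart_dom a) x ->
     curvature L (tnth rho k) a i j m n x
     = \sum_(t < 6)
         coef_vec R (tnth rho k) 0 t * basic_term L t a i j m n x)
  /\ (exists A : {set 'I_14}, #|A| = 6%N /\ lin_independent R A)
  /\ (forall A : {set 'I_14}, lin_independent R A -> (#|A| <= 6)%N).
Proof.
split; first by move=> k a i j m n x _; exact: curvatureE.
split.
  exists [set k in basis_indices]; split.
    by rewrite cardsE (card_uniqP uniq_basis_indices).
  (* Freeness ignores the order in which [enum] lists the set. *)
  rewrite /lin_independent (perm_free (Y := map _ basis_indices) (perm_map _ _)).
    exact: free_basis_rho.
  apply: uniq_perm; rewrite ?enum_uniq ?uniq_basis_indices // => k.
  by rewrite mem_enum inE.
move=> A /free_size_le_dim.
by rewrite size_map -cardE dimvf /dim /= mul1n.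
Qed.
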